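(* Let $m\in\mathbb N=\{1,2,\dots\}$, let $\lambda=(\lambda_1,\dots,\lambda_m)$ be a collection of mappings $\lambda_i:\{1,\dots,m\}\to\{1,\dots,m\}$, let $s>0$, let $(X,d)$ be a complete symmetric space whose distance $d$ is an $s$-distance, and let $F:X^m\to X$ be an operator. 1. If $F$ is a $\lambda$-contraction, then every Picard sequence of the operator $\lambda F$ is a convergent Cauchy sequence and $F$ has a unique $\lambda$-multiple fixed point. 2. If $F$ is a $\bar\lambda$-contraction and, for every $i\le m$, the mapping $\lambda_i$ is a surjection or, more generally, $\left|\bigcup\{\lambda_i^{-1}(j): j\le m\}\right|=m$ for each $i\le m$, then every Picard sequence of the operator $\lambda F$ is a convergent Cauchy sequence and $F$ has a unique $\lambda$-multiple fixed point.
   Context: A distance on a non-empty set $X$ is a mapping $d:X\times X\to\mathbb R$ with $d(x,y)\ge 0$ for all $x,y\in X$, and $d(x,y)+d(y,x)=0$ if and only if $x=y$. $(X,d)$ is a symmetric space if moreover $d(x,y)=d(y,x)$ for all $x,y\in X$. For $s>0$, $d$ is an $s$-distance if $d(x,y)\le s[d(x,z)+d(z,y)]$ for all $x,y,z\in X$. A sequence $\{x_n\}$ converges to $x$ if $\lim_{n\to\infty}d(x,x_n)=0$; it is convergent if it converges to some point of $X$; it is Cauchy if $\lim_{n,m\to\infty}d(x_n,x_m)=0$. $(X,d)$ is complete if every Cauchy sequence converges to some point of $X$. On $X^m$ consider the distances $d^m(x,y)=\sup\{d(x_i,y_i): i\le m\}$ and $\bar d^m(x,y)=\sum_{i=1}^m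 d(x_i,y_i)$, which have the same convergent sequences and the same Cauchy sequences; convergence and the Cauchy property in $X^m$ are understood with respect to these. The operator $\lambda F:X^m\to X^m$ is defined by $\lambda F(x_1,\dots,x_m)=(y_1,\dots,y_m)$ with $y_i=F(x_{\lambda_i(1)},\dots,x_{\lambda_i(m)})$ for $i=1,\dots,m$. A point $a\in X^m$ is a $\lambda$-multiple (multidimensional) fixed point of $F$ if $\lambda F(a)=a$, i.e. $a_i=F(a_{\lambda_i(1)},\dots,a_{\lambda_i(m)})$ for all $i$. For $a\in X^m$, the Picard sequence of $\lambda F$ at $a$ is $\{a(n):n\in\mathbb N\}$, where $a(1)=\lambda F(a)$ and $a(n+1)=\lambda F(a(n))$. $F$ is a $\lambda$-contraction if there is $k\in[0,1)$ with $d(F(x_1,\dots,x_m),F(y_1,\dots,y_m))\le k\sup\{d(x_i,y_i):i\le m\}$ for all $(x_1,\dots,x_m),(y_1,\dots,y_m)\in X^m$. $F$ is a $\bar\lambda$-contraction if there is $k\in[0,1)$ with $d(F(x_1,\dots,x_m),F(y_1,\dots,y_m))\le \frac{k}{m}\sum_{i=1}^m d(x_i,y_i)$ for all $(x_1,\dots,x_m),(y_1,\dots,y_m)\in X^m$. *)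

(* Defs.v *)
From mathcomp Require Import all_boot all_order all_algebra.
From mathcomp Require Import all_classical all_reals all_analysis.

Set Implicit Arguments.
Unset Strict Implicit.
Unset Printing Implicit Defensive.

Import Order.TTheory GRing.Theory Num.Theory.
Import numFieldNormedType.Exports.

Local Open Scope classical_set_scope.
Local Open Scope ring_scope.

Definition is_distance (R : realType) (X : Type) (d : X -> X -> R) : Prop :=
  (forall x y, 0 <= d x y) /\ (forall x y, d x y + d y x = 0 <-> x = y).

Definition is_symmetric_distance (R : realType) (X : Type) (d : X -> X -> R)
    : Prop :=
  is_distance d /\ (forall x y, d x y = d y x).

Definition is_s_distance (R : realType) (X : Type) (s : R) (d : X -> X -> R)
    : Prop :=
  forall x y z, d x y <= s * (d x z + d z y).

Definition converges_to (R : realType) (X : Type) (d : X -> X -> R)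
    (u : nat -> X) (x : X) : Prop :=
  d x (u n) @[n --> \oo] --> (0 : R).

Definition convergent (R : realType) (X : Type) (d : X -> X -> R)
    (u : nat -> X) : Prop :=
  exists x, converges_to d u x.

(* The double limit is taken along the product filter, i.e. as both indices
   go to infinity independently. *)
Definition is_cauchy (R : realType) (X : Type) (d : X -> X -> R)
    (u : nat -> X) : Prop :=
  d (u p.1) (u p.2) @[p --> (\oo, \oo)] --> (0 : R).

Definition is_complete (R : realType) (X : Type) (d : X -> X -> R) : Prop :=
  forall u : nat -> X, is_cauchy d u -> convergent d u.

(* The set below is finite, and nonempty as soon as [0 < m], so that [sup] is
   then its maximum. *)
Definition dist_sup (R : realType) (X : Type) (m : nat) (d : X -> X -> R)
    (x y : {ffun 'I_m -> X}) : R :=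
  sup (range (fun i : 'I_m => d (x i) (y i))).

Definition dist_sum (R : realType) (X : Type) (m : nat) (d : X -> X -> R)
    (x y : {ffun 'I_m -> X}) : R :=
  \sum_(i < m) d (x i) (y i).

Definition lambda_op (X : Type) (m : nat) (lam : 'I_m -> 'I_m -> 'I_m)
    (F : {ffun 'I_m -> X} -> X) (x : {ffun 'I_m -> X}) : {ffun 'I_m -> X} :=
  [ffun i => F [ffun j => x (lam i j)]].

Definition lambda_fixed_point (X : Type) (m : nat)
    (lam : 'I_m -> 'I_m -> 'I_m) (F : {ffun 'I_m -> X} -> X)
    (a : {ffun 'I_m -> X}) : Prop :=
  lambda_op lam F a = a.

(* Indexed from 0: the [n]-th term is a(n+1), so the sequence starts at
   a(1) = lambda_op lam F a. *)
Definition picard (X : Type) (m : nat) (lam : 'I_m -> 'I_m -> 'I_m)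
    (F : {ffun 'I_m -> X} -> X) (a : {ffun 'I_m -> X}) (n : nat)
    : {ffun 'I_m -> X} :=
  iter n.+1 (lambda_op lam F) a.

(* Convergence and the Cauchy property in X^m are required for both of the
   (equivalent) product distances. *)
Definition convergent_cauchy (R : realType) (X : Type) (m : nat)
    (d : X -> X -> R) (u : nat -> {ffun 'I_m -> X}) : Prop :=
  (is_cauchy (dist_sup d) u /\ convergent (dist_sup d) u) /\
  (is_cauchy (dist_sum d) u /\ convergent (dist_sum d) u).

(* Neither contraction condition involves the maps lambda_i. *)
Definition lambda_contraction (R : realType) (X : Type) (m : nat)
    (d : X -> X -> R) (F : {ffun 'I_m -> X} -> X) : Prop :=
  exists k : R, 0 <= k < 1 /\
    forall x y : {ffun 'I_m -> X}, d (F x) (F y) <= k * dist_sup d x y.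

Definition lambda_bar_contraction (R : realType) (X : Type) (m : nat)
    (d : X -> X -> R) (F : {ffun 'I_m -> X} -> X) : Prop :=
  exists k : R, 0 <= k < 1 /\
    forall x y : {ffun 'I_m -> X}, d (F x) (F y) <= k / m%:R * dist_sum d x y.

(* Main.v *)
(* An average is at most a maximum, so a bar-contraction is a contraction with
   the same constant k. For a contraction F the operator lambda F is k-Lipschitz
   for the sup distance on X^m, whatever the maps lambda_i, and this distance is
   again a complete symmetric s-distance. Its Picard orbits are bounded, hence
   Cauchy because D(G^i a, G^(i+j) a) <= k^i D(a, G^j a), and the limit of an
   orbit is the unique fixed point. *)
Require Import Defs.
From mathcomp Require Import all_boot all_order all_algebra.
From mathcomp Require Import all_classical all_reals all_analysis.
From mathcomp Require Import lra.

Set Implicit Arguments.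
Unset Strict Implicit.
Unset Printing Implicit Defensive.

Import Order.TTheory GRing.Theory Num.Theory.
Import numFieldNormedType.Exports.

Local Open Scope ring_scope.

(** * Comparison of null families along a filter *)

Lemma cvg0_le (R : realType) (T : Type) (E : set_system T) (FE : Filter E)
    (c : R) (f g : T -> R) :
  (forall t, 0 <= f t <= c * g t) -> (g @ E --> (0 : R))%classic ->
  (f @ E --> (0 : R))%classic.
Proof.
move=> fg g0; apply: (@squeeze_cvgr _ _ _ _ (fun=> 0) (fun t => c * g t)).
- by near=> t; exact: fg.
- exact: cvg_cst.
- by rewrite -[X in (_ --> X)%classic](mulr0 c); exact: cvgMr.
Unshelve. all: by end_near. Qed.

(** The two sequences may live in different spaces, so that the Cauchy property passes from a
    product to its coordinates. *)
Lemma cauchy_le (R : realType) (X Y : Type) (d : X -> X -> R)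
    (e : Y -> Y -> R) (c : R) (u : nat -> X) (v : nat -> Y) :
  (forall i j, 0 <= d (u i) (u j) <= c * e (v i) (v j)) ->
  is_cauchy e v -> is_cauchy d u.
Proof. by move=> de; apply: (@cvg0_le _ _ _ _ c) => p; exact: de. Qed.

Lemma converges_le (R : realType) (X Y : Type) (d : X -> X -> R)
    (e : Y -> Y -> R) (c : R) (u : nat -> X) (v : nat -> Y) (x : X) (y : Y) :
  (forall i, 0 <= d x (u i) <= c * e y (v i)) ->
  converges_to e v y -> converges_to d u x.
Proof. by move=> de; apply: (@cvg0_le _ _ _ _ c). Qed.

(** * Orbits and fixed points of a contraction for a symmetric s-distance *)

Section Contraction.
Variables (R : realType) (Y : Type) (D : Y -> Y -> R) (s k : R) (G : Y -> Y).
Hypotheses (s_gt0 : 0 < s) (k_ge0 : 0 <= k) (k_lt1 : k < 1).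
Hypotheses (Dsym : is_symmetric_distance D) (Ds : is_s_distance s D).
Hypothesis DG : forall x y, D (G x) (G y) <= k * D x y.

Let D_ge0 x y : 0 <= D x y.
Proof. by case: Dsym => -[]. Qed.

Let D_sym x y : D x y = D y x.
Proof. by case: Dsym. Qed.

Let D_le0 x y : D x y <= 0 -> x = y.
Proof.
move=> h; case: Dsym => -[_ <-] _.
by have := D_ge0 x y; have := D_sym x y; lra.
Qed.

Lemma expr_cvg0 : (k ^+ n @[n --> \oo] --> (0 : R))%classic.
Proof. by apply: cvg_expr; rewrite ger0_norm. Qed.

Lemma iter_contraction n x y : D (iter n G x) (iter n G y) <= k ^+ n * D x y.
Proof.
elim: n => [|n IHn]; first by rewrite mul1r.
by rewrite exprS -mulrA /=; apply: le_trans (DG _ _) _; exact: ler_wpM2l.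
Qed.

(* As s k may exceed 1, the induction passes through an iterate G^p with
   s k^p <= 1/2: D(a, G^n a) <= s D(a, G^p a) + D(a, G^(n-p) a) / 2. *)
Lemma orbit_bounded a : exists B, forall n, D a (iter n G a) <= B.
Proof.
have [p p_gt0 sp] : exists2 p, (0 < p)%N & s * k ^+ p <= 1 / 2.
  have /cvgr_lt : (s * k ^+ n @[n --> \oo] --> (0 : R))%classic.
    by rewrite -[X in (_ --> X)%classic](mulr0 s); apply: cvgMr expr_cvg0.
  move=> /(_ (1 / 2)) []; first lra.
  (* The successor makes the exponent positive, so that [n - p] is smaller than [n] in the induction
     below. *)
  by move=> p _ /(_ p.+1 (leqnSn p)) /ltW; exists p.+1.
pose M := \sum_(i < p.+1) D a (iter i G a).
have leM i : (i <= p)%N -> D a (iter i G a) <= M.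
  move=> ip; rewrite /M (bigD1 (Ordinal (ip : (i < p.+1)%N))) //= lerDl.
  by apply: sumr_ge0.
have M_ge0 : 0 <= M by apply: sumr_ge0.
(* A bound [B] must satisfy [M <= B] for the first [p] iterates and [s * M + B / 2 <= B] for the
   inductive step. *)
exists (M + 2 * s * M) => n.
have [m] := ubnP n; elim: m n => // m IHm n nm.
have sM_ge0 : 0 <= s * M by apply: mulr_ge0 => //; exact: ltW.
have [/leM|pn] := leqP n p; first lra.
have npm : (n - p < m)%N.
  by rewrite -ltnS (leq_trans _ nm)// ltnS ltn_subrL p_gt0 (leq_trans _ pn).
have := IHm _ npm.
have := iter_contraction p a (iter (n - p) G a).
rewrite -iterD subnKC ?(ltnW pn)// => h1 h2.
have h3 := Ds a (iter n G a) (iter p G a).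
have h4 := leM p (leqnn p).
have h5 := D_ge0 a (iter (n - p) G a).
have h6 : s * D (iter p G a) (iter n G a) <= 1 / 2 * D a (iter (n - p) G a).
  apply: le_trans (ler_wpM2r h5 sp); rewrite -mulrA.
  by apply: ler_wpM2l => //; exact: ltW.
have h7 : s * D a (iter p G a) <= s * M by apply: ler_wpM2l => //; exact: ltW.
rewrite mulrDr in h3; lra.
Qed.

Lemma orbit_cauchy a : is_cauchy D (fun n => iter n G a).
Proof.
have [B DB] := orbit_bounded a.
have B_ge0 : 0 <= B by exact: le_trans (D_ge0 _ _) (DB 0%N).
have DkB i j : D (iter i G a) (iter (i + j) G a) <= k ^+ i * B.
  rewrite iterD; apply: le_trans (iter_contraction _ _ _) _.
  by apply: ler_wpM2l => //; exact: exprn_ge0.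
(* The smaller index gives the bound; the sum of both powers dominates it in either case and tends
   to 0 along the product filter. *)
apply: (@cvg0_le _ _ _ _ B _ (fun p : nat * nat => k ^+ p.1 + k ^+ p.2)).
  move=> [i j] /=; rewrite D_ge0 /= mulrC mulrDl.
  have hi : 0 <= k ^+ i * B by rewrite mulr_ge0// exprn_ge0.
  have hj : 0 <= k ^+ j * B by rewrite mulr_ge0// exprn_ge0.
  case: (leqP i j) => [|/ltnW] ij.
    by have := DkB i (j - i)%N; rewrite subnKC//; lra.
  by have := DkB j (i - j)%N; rewrite subnKC// D_sym; lra.
rewrite -[X in (_ --> X)%classic](addr0 0); apply: cvgD.
  by apply: (cvg_comp _ _ _ expr_cvg0); exact: cvg_fst.
by apply: (cvg_comp _ _ _ expr_cvg0); exact: cvg_snd.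
Qed.

(** An s-distance need not be continuous, so no limit is taken inside [D]: [D x (G x)] is at most [s
    * (D x (iter n.+1 G a) + k * D x (iter n G a))], which tends to 0. *)
Lemma orbit_limit_fixed a x : converges_to D (fun n => iter n G a) x -> G x = x.
Proof.
move=> ux; apply/esym/D_le0.
have uSx : (D x (iter n.+1 G a) @[n --> \oo] --> (0 : R))%classic.
  by move: ux; rewrite /converges_to -[X in X -> _]cvg_shiftS.
have ux0 : (s * (D x (iter n.+1 G a) + k * D x (iter n G a)) @[n --> \oo]
             --> (0 : R))%classic.
  rewrite -[X in (_ --> X)%classic](mulr0 s); apply: cvgMr.
  rewrite -[X in (_ --> X)%classic](addr0 0); apply: cvgD => //.
  by rewrite -[X in (_ --> X)%classic](mulr0 k); exact: cvgMr.
rewrite -(cvg_lim _ ux0)//; apply: limr_ge; first by apply: cvgP ux0.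
apply: nearW => n; apply: le_trans (Ds _ _ (iter n.+1 G a)) _.
apply: ler_wpM2l; first exact: ltW.
by rewrite lerD2l /= (D_sym x); exact: DG.
Qed.

Lemma contraction_fixed_unique x y : G x = x -> G y = y -> x = y.
Proof.
move=> Gx Gy; apply: D_le0; have := DG x y; rewrite Gx Gy.
(* [D x y <= k * D x y] becomes [0 <= (k - 1) * D x y] with [k - 1 < 0]. *)
by rewrite -subr_ge0 -[X in _ - X]mul1r -mulrBl nmulr_rge0 ?subr_lt0.
Qed.

End Contraction.

(** * The sup and sum distances on [X^m] *)

Section Product.
Variables (R : realType) (X : Type) (m : nat) (d : X -> X -> R).
Hypotheses (m_gt0 : (0 < m)%N) (d_sym : is_symmetric_distance d).

Let d_ge0 x y : 0 <= d x y.
Proof. by case: d_sym => -[]. Qed.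

Lemma dist_sum_ge (x y : {ffun 'I_m -> X}) i : d (x i) (y i) <= dist_sum d x y.
Proof. by rewrite /dist_sum (bigD1 i)//= lerDl; exact: sumr_ge0. Qed.

Lemma dist_sup_ge (x y : {ffun 'I_m -> X}) i : d (x i) (y i) <= dist_sup d x y.
Proof.
apply: ub_le_sup; last by exists i.
(* The sum bounds the set of coordinate distances, so its [sup] is a true upper bound. *)
by exists (dist_sum d x y) => _ [j _ <-]; exact: dist_sum_ge.
Qed.

Lemma dist_sup_le (x y : {ffun 'I_m -> X}) c :
  (forall i, d (x i) (y i) <= c) -> dist_sup d x y <= c.
Proof.
move=> dc; apply: ge_sup; last by move=> _ [i _ <-].
(* Positivity of [m] makes the set non-empty, so [sup] is not a default value. *)
by exists (d (x (Ordinal m_gt0)) (y (Ordinal m_gt0))), (Ordinal m_gt0).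
Qed.

Lemma dist_sup_ge0 (x y : {ffun 'I_m -> X}) : 0 <= dist_sup d x y.
Proof. exact: le_trans (d_ge0 _ _) (dist_sup_ge x y (Ordinal m_gt0)). Qed.

Lemma dist_sup_le_sum (x y : {ffun 'I_m -> X}) :
  dist_sup d x y <= dist_sum d x y.
Proof. by apply: dist_sup_le => i; exact: dist_sum_ge. Qed.

Lemma dist_sum_le_sup (x y : {ffun 'I_m -> X}) :
  dist_sum d x y <= m%:R * dist_sup d x y.
Proof.
rewrite mulr_natl -[X in _ *+ X]card_ord -sumr_const; apply: ler_sum => i _.
exact: dist_sup_ge.
Qed.

Lemma dist_sum_ge0 (x y : {ffun 'I_m -> X}) : 0 <= dist_sum d x y.
Proof. exact: sumr_ge0. Qed.

Lemma dist_sup_symmetric : is_symmetric_distance (@dist_sup R X m d).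
Proof.
have [[_ d0] dC] := d_sym.
split; last first.
  move=> x y; rewrite /dist_sup.
  suff -> : (fun i => d (x i) (y i)) = (fun i => d (y i) (x i)) by [].
  exact/funext.
split=> [x y|x y]; first exact: dist_sup_ge0.
split=> [h|->].
  apply/ffunP => i; apply/d0; apply/eqP; rewrite eq_le addr_ge0// andbT -h.
  by apply: lerD; exact: dist_sup_ge.
suff -> : dist_sup d y y = 0 by rewrite addr0.
apply/eqP; rewrite eq_le dist_sup_ge0 andbT; apply: dist_sup_le => i.
by have := (d0 (y i) (y i)).2 erefl; have := d_ge0 (y i) (y i); lra.
Qed.

Lemma dist_sup_s (s : R) : 0 <= s -> is_s_distance s d ->
  is_s_distance s (@dist_sup R X m d).
Proof.
move=> s_ge0 ds x y z; apply: dist_sup_le => i.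
apply: le_trans (ds _ _ (z i)) _; apply: ler_wpM2l => //.
by apply: lerD; exact: dist_sup_ge.
Qed.

(** Each coordinate of a Cauchy sequence is Cauchy, and the chosen coordinate limits form the limit
    tuple. Convergence is checked on the larger sum distance, a finite sum of null sequences. *)
Lemma dist_sup_complete : is_complete d -> is_complete (@dist_sup R X m d).
Proof.
move=> dC u uC.
have /choice[x ux] : forall i, exists z, converges_to d (fun n => u n i) z.
  move=> i; apply: dC; apply: (@cauchy_le _ _ _ _ (dist_sup d) 1) uC => n n'.
  by rewrite mul1r d_ge0 dist_sup_ge.
exists [ffun i => x i].
apply: (@cvg0_le _ _ _ _ 1 _ (fun n => dist_sum d [ffun i => x i] (u n))).
  by move=> n; rewrite mul1r dist_sup_ge0 dist_sup_le_sum.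
have : (dist_sum d [ffun i => x i] (u n) @[n --> \oo]
    --> \sum_(i < m) (0 : R))%classic.
  apply: cvg_big => [|i _]; first exact: add_continuous.
  by rewrite ffunE; exact: ux.
by rewrite big1_eq.
Qed.

Lemma convergent_cauchy_sup (u : nat -> {ffun 'I_m -> X}) :
  is_cauchy (dist_sup d) u -> convergent (dist_sup d) u ->
  convergent_cauchy d u.
Proof.
move=> uC [x ux]; split; split => //; first by exists x.
  apply: (@cauchy_le _ _ _ _ (dist_sup d) m%:R) uC => i j.
  by rewrite dist_sum_ge0 dist_sum_le_sup.
exists x; apply: (@converges_le _ _ _ _ (dist_sup d) m%:R _ u _ x) ux => i.
by rewrite dist_sum_ge0 dist_sum_le_sup.
Qed.

Lemma lambda_op_contraction (k : R) (lam : 'I_m -> 'I_m -> 'I_m)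
    (F : {ffun 'I_m -> X} -> X) : 0 <= k ->
  (forall x y, d (F x) (F y) <= k * dist_sup d x y) ->
  forall x y, dist_sup d (lambda_op lam F x) (lambda_op lam F y)
    <= k * dist_sup d x y.
Proof.
move=> k_ge0 dF x y; apply: dist_sup_le => i; rewrite !ffunE.
apply: le_trans (dF _ _) _; apply: ler_wpM2l => //.
(* Reindexing by [lam i] only selects or repeats coordinates, so it cannot increase the sup
   distance. *)
by apply: dist_sup_le => j; rewrite !ffunE; exact: dist_sup_ge.
Qed.

Lemma lambda_contraction_bar (F : {ffun 'I_m -> X} -> X) :
  lambda_bar_contraction d F -> lambda_contraction d F.
Proof.
move=> [k [k01 dF]]; exists k; split=> // x y; apply: le_trans (dF x y) _.
have /andP[k_ge0 _] := k01.
rewrite -mulrA; apply: ler_wpM2l => //.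
by rewrite ler_pdivrMl ?ltr0n// dist_sum_le_sup.
Qed.

End Product.

(** * Application to the operator [lambda_op lam F] *)

Lemma lambda_contraction_picard (R : realType) (m : nat) (m_gt0 : (0 < m)%N)
    (lam : 'I_m -> 'I_m -> 'I_m) (s : R) (s_gt0 : 0 < s)
    (X : Type) (X_nonempty : inhabited X) (d : X -> X -> R)
    (d_sym : is_symmetric_distance d) (d_s : is_s_distance s d)
    (d_complete : is_complete d) (F : {ffun 'I_m -> X} -> X) :
  lambda_contraction d F ->
  (forall a : {ffun 'I_m -> X}, convergent_cauchy d (picard lam F a)) /\
  (exists! a : {ffun 'I_m -> X}, lambda_fixed_point lam F a).
Proof.
move=> [k [/andP[k_ge0 k_lt1] dF]].
have Dsym := dist_sup_symmetric m_gt0 d_sym.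
have Ds := dist_sup_s m_gt0 d_sym (ltW s_gt0) d_s.
have DG := lambda_op_contraction m_gt0 d_sym lam k_ge0 dF.
have DC := dist_sup_complete m_gt0 d_sym d_complete.
have cauchy := orbit_cauchy s_gt0 k_ge0 k_lt1 Dsym Ds DG.
split=> [a|].
  (* Since [picard] starts at the first iterate, it is the orbit of [lambda_op lam F a] indexed from
     0. *)
  have -> : picard lam F a = fun n => iter n (lambda_op lam F) (lambda_op lam F a).
    by apply/funext => n; rewrite /picard iterSr.
  apply: convergent_cauchy_sup => //; apply: DC; exact: cauchy.
have [x0] := X_nonempty.
(* Any starting tuple would do; a constant one exists because [X] is non-empty. *)
have [x ux] := DC _ (cauchy [ffun=> x0]).
have Gx := orbit_limit_fixed s_gt0 Dsym Ds DG ux.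
exists x; split=> // y; exact: (contraction_fixed_unique k_lt1 Dsym DG Gx).
Qed.

Theorem theorem4p6 (R : realType) (m : nat) (m_gt0 : (0 < m)%N)
    (lam : 'I_m -> 'I_m -> 'I_m) (s : R) (s_gt0 : 0 < s)
    (X : Type) (X_nonempty : inhabited X) (d : X -> X -> R)
    (d_sym : is_symmetric_distance d) (d_s : is_s_distance s d)
    (d_complete : is_complete d) (F : {ffun 'I_m -> X} -> X) :
  (lambda_contraction d F ->
     (forall a : {ffun 'I_m -> X}, convergent_cauchy d (picard lam F a)) /\
     (exists! a : {ffun 'I_m -> X}, lambda_fixed_point lam F a))
  /\
  (lambda_bar_contraction d F ->
   (forall i : 'I_m, forall j : 'I_m, exists l : 'I_m, lam i l = j) \/
   (forall i : 'I_m,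
      #|(\bigcup_(j : 'I_m) (lam i @^-1: [set j]))%SET| = m) ->
     (forall a : {ffun 'I_m -> X}, convergent_cauchy d (picard lam F a)) /\
     (exists! a : {ffun 'I_m -> X}, lambda_fixed_point lam F a)).

Proof.
have main := lambda_contraction_picard m_gt0 lam s_gt0 X_nonempty
  d_sym d_s d_complete (F := F).
split=> // /(lambda_contraction_bar m_gt0 d_sym) /main //.
Qed.
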